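(* Let $G$ be a group and let $A \subseteq G$ be an infinite generating set for $G$. If $r$ is an integer with $r > 1$ and $L_A(r) < \infty$, then $L_A(r') = 0$ for all integers $r' > r$.
   Context: A subset $A$ of a group $G$ is a generating set for $G$ if every element of $G$ is a finite product of elements of $A \cup A^{-1}$, where $A^{-1} = \{a^{-1} : a \in A\}$ and the empty product is the identity $e$. Generating sets are not required to be minimal. For $x \in G$, the word length $\ell_A(x)$ is the smallest integer $r \ge 0$ such that $x$ is a product of $r$ elements of $A \cup A^{-1}$ (so $\ell_A(e) = 0$). For every nonnegative integer $r$, the sphere of radius $r$ is $S_A(r) = \{x \in G : \ell_A(x) = r\}$, and the word growth function is $L_A(r) = |S_A(r)| \in \{0,1,2,\ldots\} \cup \{\infty\}$. *)

(* Defs.v *)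
From mathcomp Require Import all_boot all_order all_algebra finmap.
From mathcomp Require Import boolp classical_sets functions cardinality.
From mathcomp Require Import constructive_ereal.

Set Implicit Arguments.
Unset Strict Implicit.
Unset Printing Implicit Defensive.

Local Open Scope classical_set_scope.

Section WordGrowth.
Context {G : groupType}.
Implicit Types (A : set G) (x : G) (r : nat).

(* The empty product (r = 0) is the identity. *)
Definition product_of A r x : Prop :=
  exists w : seq G,
    [/\ size w = r,
        forall a, a \in w -> (A `|` [set (a^-1)%g | a in A]) a
      & x = \big[*%g/1%g]_(a <- w) a].

Definition generating_set A : Prop := forall x, exists r, product_of A r x.

Lemma generating_set_asbool A (gA : generating_set A) x :
  exists r, `[< product_of A r x >].
Proof. by have [r Ar] := gA x; exists r; apply/asboolP. Qed.

(* The proof that A generates G only serves to make the minimum exist. *)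
Definition word_length A (gA : generating_set A) x : nat :=
  ex_minn (generating_set_asbool gA x).

Definition sphere A (gA : generating_set A) r : set G :=
  [set x | word_length gA x = r].

(* The extended integers provide the order and +oo; only the values
   0, 1, 2, ... and +oo are taken. *)
Definition word_growth A (gA : generating_set A) r : \bar int :=
  if `[< finite_set (sphere gA r) >]
  then (Posz #|` fset_set (sphere gA r)|)%:E else +oo%E.

End WordGrowth.

(* Main.v *)
(** Let B be the ball of radius r - 1. For a letter b, an element of B that
    left multiplication by b moves out of B is sent into the finite sphere of
    radius r, so there are finitely many of them; by induction on word length
    the same holds with any x in place of b. As r > 1, the infinite set A lies
    in B, so x * a is in B for some a in A, and x = (x * a) * a^-1 has length at
    most r. Thus the whole group is the ball of radius r. *)
Require Import Defs.
From mathcomp Require Import all_boot all_order all_algebra finmap.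
From mathcomp Require Import boolp classical_sets functions cardinality.
From mathcomp Require Import constructive_ereal.

Set Implicit Arguments.
Unset Strict Implicit.
Unset Printing Implicit Defensive.

Local Open Scope classical_set_scope.
Local Open Scope group_scope.

Section WordLength.
Context {G : groupType}.
Variables (A : set G) (gA : generating_set A).
Implicit Types (a b x m : G) (r n : nat).

Local Notation letter := (A `|` [set a^-1 | a in A]).

Lemma product_of_word_length x : product_of A (word_length gA x) x.
Proof. by rewrite /word_length; case: ex_minnP => n /asboolP. Qed.

Lemma word_length_min n x : product_of A n x -> (word_length gA x <= n)%N.
Proof.
by rewrite /word_length; case: ex_minnP => k _ kmin /asboolP; apply: kmin.
Qed.

Lemma product_of_letter a : letter a -> product_of A 1 a.
Proof.
by exists [:: a]; split=> // [b|]; rewrite ?inE ?big_seq1 // => /eqP->.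
Qed.

Lemma product_ofM n k x y :
  product_of A n x -> product_of A k y -> product_of A (n + k) (x * y).
Proof.
move=> [v [<- vA ->]] [w [<- wA ->]]; exists (v ++ w).
split; rewrite ?size_cat ?big_cat // => a; rewrite mem_cat.
by case/orP => [/vA|/wA].
Qed.

Lemma word_length_letter a : letter a -> (word_length gA a <= 1)%N.
Proof. by move=> /product_of_letter; apply: word_length_min. Qed.

Lemma word_lengthM x y :
  (word_length gA (x * y) <= word_length gA x + word_length gA y)%N.
Proof.
by apply: word_length_min; apply: product_ofM; apply: product_of_word_length.
Qed.

(** Apply the letters of a word for [x] from right to left: an [m] that ends outside the ball is
    either already outside after the tail [g], or is carried out by the leading letter [b], which
    lands exactly on the sphere. *)
Lemma finite_escape_ball r x : finite_set (sphere gA r.+1) ->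
  finite_set [set m | (word_length gA m <= r)%N
                      /\ (r < word_length gA (x * m))%N].
Proof.
move=> finS; have [n [w [_ wA ->]]] := gA x.
elim: w wA => [_|b w IHw wA].
  rewrite big_nil (_ : [set m | _] = set0) // -subset0 => m /= [].
  by rewrite mul1g ltnNge => ->.
rewrite big_cons; set g := \big[_/_]_(_ <- _) _ in IHw *.
have letb : letter b by apply: wA; rewrite mem_head.
have finw : finite_set [set m | (word_length gA m <= r)%N
                                /\ (r < word_length gA (g * m))%N].
  by apply: IHw => a aw; apply: wA; rewrite inE aw orbT.
(* Left translation by [b * g] is injective, so it pulls the finite sphere back to a finite set. *)
have finb : finite_set ((fun m => b * g * m) @^-1` sphere gA r.+1).
  by apply: finite_preimage => // m m' _ _; apply: mulgI.
apply: sub_finite_set (_ : finite_set (_ `|` _)); last first.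
  by rewrite finite_setU; split; [exact: finw | exact: finb].
move=> m /= [mr rm]; have [gm|gm] := ltnP r (word_length gA (g * m)).
  by left.
(* A letter raises the length by at most 1, so a length above [r] must be [r.+1]. *)
right; rewrite /sphere /=; apply/eqP; rewrite eqn_leq rm andbT -mulgA.
apply: leq_trans (word_lengthM _ _) _.
by rewrite -add1n leq_add // word_length_letter.
Qed.

Lemma word_length_le_finite_sphere r x : infinite_set A -> (1 < r)%N ->
  finite_set (sphere gA r) -> (word_length gA x <= r)%N.
Proof.
(* The new [r] is the radius of the ball; it is positive, so the ball contains every letter. *)
case: r => // r infA r_gt0 finS.
have finE := finite_escape_ball x finS.
(* Only finitely many elements of the ball escape under [x], so some [a] in [A] does not. *)
have [a [Aa Ea]] := infinite_setN0 (infinite_setD infA finE).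
have a_le1 : (word_length gA a <= r)%N.
  by apply: leq_trans (word_length_letter _) _; [left | rewrite -ltnS].
have xa_le : (word_length gA (x * a) <= r)%N.
  by rewrite leqNgt; apply/negP => xa_gt; apply: Ea.
rewrite -[x](mulgK a) -addn1; apply: leq_trans (word_lengthM _ _) _.
by rewrite leq_add // word_length_letter //; right; exists a.
Qed.

End WordLength.

Theorem theorem1 (G : groupType) (A : set G) (gA : generating_set A)
    (infA : infinite_set A) (r : nat) (r_gt1 : (1 < r)%N)
    (Lr_fin : (word_growth gA r < +oo)%E) :
  forall r' : nat, (r < r')%N -> word_growth gA r' = 0%E.
Proof.
move=> r' rr'.
have finS : finite_set (sphere gA r).
  (* An infinite sphere would give the value [+oo], against [Lr_fin]. *)
  by move: Lr_fin; rewrite /word_growth; case: asboolP.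
have S0 : sphere gA r' = set0.
  rewrite -subset0 => x /= xr'.
  have := word_length_le_finite_sphere x infA r_gt1 finS.
  by rewrite xr' leqNgt rr'.
rewrite /word_growth S0; case: asboolP => [_|[]]; last exact: finite_set0.
by rewrite fset_set0 cardfs0.
Qed.
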